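(* For two oriented virtual knots $K$ and $K'$, we have the following. (i) ${\rm d}_X(K,K')\geq \frac{1}{2}|J(K)-J(K')|$ for $X\in\{v\Delta^\wedge, v\Delta^\circ, vp\}$. (ii) ${\rm d}_{v\sharp}(K,K')\geq \frac{1}{4}|J(K)-J(K')|$. In particular, ${\rm u}_X(K)\geq \frac{1}{2}|J(K)|$ for $X\in\{v\Delta^\wedge, v\Delta^\circ, vp\}$, and ${\rm u}_{v\sharp}(K)\geq \frac{1}{4}|J(K)|$.
   Context: Virtual knots. An oriented virtual knot diagram is a generic immersion of an oriented circle into the plane, each double point of which is either a real crossing (with over/under information) or a virtual crossing. The generalized Reidemeister moves are: the Reidemeister moves I, II, III for real crossings; their analogues in which all crossings are virtual; and the mixed move in which a strand having two virtual crossings is passed across a real crossing. An oriented virtual knot is an equivalence class of diagrams under generalized Reidemeister moves (and planar isotopy). Virtualized $\Delta$-moves. Consider a disk meeting the diagram in three oriented strands, any two of which cross exactly once, so that the three crossings are the vertices of a triangle. A $v\Delta$-move replaces three real crossings, where each of the three strands passes over at one of its two crossings and under at the other, by three virtual crossings, or is the inverse of this replacement. It is a $v\Delta^\circ$-move if the three sides of the triangle, with the orientations of the strands, form a coherently oriented cycle (equivalently, the three real crossings have the same sign); otherwise it is a $v\Delta^\wedge$-move. Virtualized $\sharp$- and pass-moves. Consider a disk meeting the diagram in a pair of parallel, disjoint strands and another pair of parallel, disjoint strands, where each strand of the first pair crosses each strand of the second pair exactly once. The move in question replaces four real crossings at which both strands of the first pair pass over both strands of the second pair by four virtual crossings, or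 is the inverse of this replacement. It is a $v\sharp$-move if within each pair the two strands are oriented in the same direction, and a $vp$-move if within each pair the two strands are oriented in opposite directions. Distances. For $X\in\{v\Delta^\wedge, v\Delta^\circ, v\sharp, vp\}$, any two oriented virtual knots have diagrams related by finitely many $X$-moves and generalized Reidemeister moves. ${\rm d}_X(K,K')$ is the minimal number of $X$-moves required to deform a diagram of $K$ into that of $K'$ (generalized Reidemeister moves being used freely), and ${\rm u}_X(K)={\rm d}_X(K,O)$, where $O$ is the trivial knot. Writhes. The Gauss diagram $G$ of a diagram of $K$ is the oriented circle that is the preimage of the immersion, with a chord joining the two preimages of each real crossing, oriented from the overcrossing to the undercrossing and equipped with the sign of the crossing. If a chord has sign $\varepsilon$, its initial endpoint is given the sign $-\varepsilon$ and its terminal endpoint the sign $\varepsilon$. For a chord $\gamma$, let $\alpha$ be the open arc of the circle running, along its orientation, from the initial endpoint of $\gamma$ to its terminal endpoint; the index ${\rm Ind}(\gamma)$ is the sum of the signs of all endpoints of chords on $\alpha$. For $n\neq 0$, the $n$-writhe $J_n(K)$ is the sum of the signs of all chords of index $n$; it is an invariant of $K$. The odd writhe is $J(K)=\sum_{n\,\text{odd}}J_n(K)$. *)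

(* Defs.v *)
From HB Require Import structures.
From mathcomp Require Import all_boot all_order all_algebra generic_quotient.
From mathcomp Require Import boolp classical_sets functions cardinality fsbigop.
From mathcomp Require Import reals constructive_ereal ereal.
From Stdlib Require Import Relation_Operators.

Set Implicit Arguments.
Unset Strict Implicit.
Unset Printing Implicit Defensive.

Import Order.TTheory GRing.Theory Num.Theory.

(** * Oriented virtual knot diagrams

  A generic immersion of an oriented circle in the plane, up to planar isotopy,
  is encoded by the cyclic word of the passages of the curve through its double
  points (real and virtual alike), read along the orientation from a base point
  which is not a double point.  The word, with the way the two branches cross
  at each double point, determines an oriented 4-valent surface map; the curve
  lies in the sphere iff this map has genus 0.  The plane is the sphere with a
  marked (unbounded) face, and the base point is taken on the boundary of that
  face. *)

Inductive level := Over | Under | Virtual.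

Definition level_code (l : level) : option bool :=
  match l with Over => Some true | Under => Some false | Virtual => None end.
Definition level_decode (o : option bool) : level :=
  match o with Some true => Over | Some false => Under | None => Virtual end.
Lemma level_codeK : cancel level_code level_decode.
Proof. by case. Qed.
HB.instance Definition _ := Countable.copy level (can_type level_codeK).

(** A passage [(n, e, v)] is one of the two passages through the double point
  named [n]; [e] holds iff the other branch crosses this one from its right to
  its left, i.e. (this branch, other branch) is a positively oriented frame. *)
Definition passage : Type := nat * bool * level.
HB.instance Definition _ := Countable.on passage.

Definition name (p : passage) : nat := p.1.1.
Definition frame (p : passage) : bool := p.1.2.
Definition lev (p : passage) : level := p.2.

Definition mate (p : passage) : passage :=
  (name p, ~~ frame p,
   match lev p with Over => Under | Under => Over | Virtual => Virtual end).

Definition well_formed (w : seq passage) : bool :=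
  all (fun p => (mate p \in w) && (count (fun q => name q == name p) w == 2)) w.

(** Edge [i] joins passage [i] to passage [i+1] (cyclically).  The dart
  [(i, true)] is edge [i] along the orientation, [(i, false)] is edge [i] in
  the opposite direction.  Two darts are in the same orbit of [turn_left] iff
  the same face lies on their left. *)
Definition letter (w : seq passage) (i : 'I_(size w)) : passage :=
  tnth (in_tuple w) i.

Definition partner (w : seq passage) (i : 'I_(size w)) : 'I_(size w) :=
  odflt i [pick k | letter k == mate (letter i)].

Definition turn_left (w : seq passage) (x : 'I_(size w) * bool) :
    'I_(size w) * bool :=
  let: (i, d) := x in
  let j := if d then ordS i else i in
  let k := partner j in
  if frame (letter j) == d then (k, true) else (ord_pred k, false).

(** V - E + F = 2, with V = size w / 2 and E = size w; the embedded circle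
  ([w] empty) is planar. *)
Definition planar (w : seq passage) : bool :=
  (size w == 0) || (fcard (@turn_left w) predT == (size w)./2 + 2).

(** [outer_left] tells whether the unbounded face is on the left or on the
  right of the edge carrying the base point, which joins the last passage of
  the word to the first one. *)
Record vdiagram := VDiagram {
  code : seq passage * bool;
  code_valid : well_formed code.1 && planar code.1 }.
HB.instance Definition _ := [isSub for code].
HB.instance Definition _ := [Countable of vdiagram by <:].

Definition word (D : vdiagram) : seq passage := (code D).1.
Definition outer_left (D : vdiagram) : bool := (code D).2.

(** The positively oriented embedded circle. *)
Definition trivial_diagram : vdiagram := @VDiagram ([::], false) isT.

(** Encodings of the same planar isotopy class: other names for the double
  points, or another base point on the boundary of the unbounded face. *)
Definition renamed (D D' : vdiagram) : Prop :=
  exists f : nat -> nat, injective f /\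
    code D' = ([seq (f (name p), frame p, lev p) | p <- word D], outer_left D).

Definition rebased (D D' : vdiagram) : Prop :=
  exists k (i j : 'I_(size (word D))),
    [/\ k < size (word D), i.+1 = size (word D), ordS j = k :> nat,
        fconnect (@turn_left (word D)) (i, outer_left D) (j, outer_left D')
      & word D' = rot k (word D)].

(** * Local moves *)

(** The part of a diagram outside a disk met by [m] strands: a word in which
  each strand inside the disk is replaced by a hole. *)
Definition fill m (C : seq (passage + 'I_m)) (T : 'I_m -> seq passage) :
    seq passage :=
  flatten [seq match x with inl p => [:: p] | inr i => T i end | x <- C].

(** [D'] is obtained from [D] by replacing the tangle [T] in a disk by [T']. *)
Definition tangle_move m (T T' : 'I_m -> seq passage) (D D' : vdiagram) : Prop :=
  exists C : seq (passage + 'I_m),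
    [/\ forall i : 'I_m, count_mem (inr i) C = 1,
        word D = fill C T, word D' = fill C T'
      & outer_left D = outer_left D'].

(** A disk containing [m] strands that bound an [m]-gon.  The strands
  [0, ..., m-1] are numbered counterclockwise along the polygon; [c i] is the
  name of the crossing of strands [i] and [i+1], which is virtual if [k i] is
  [None], and at which strand [i] is over (resp. under) strand [i+1] if [k i] is
  [Some true] (resp. [Some false]); [l i] holds iff strand [i] runs
  counterclockwise along the polygon.  At the crossing of strands [i] and [i+1],
  the counterclockwise directions of these strands form a positive frame, and
  each reversal changes its orientation. *)
Definition strand m (c : 'I_m -> nat) (k : 'I_m -> option bool)
    (l : 'I_m -> bool) (i : 'I_m) : seq passage :=
  let h := ord_pred i in
  let to_prev := (c h, l h != l i, level_decode (omap negb (k h))) in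
  let to_next := (c i, l i == l (ordS i), level_decode (k i)) in
  if l i then [:: to_prev; to_next] else [:: to_next; to_prev].

Definition no_crossing m (i : 'I_m) : seq passage := [::].

Definition all_virtual {m} (i : 'I_m) : option bool := None.

Definition layered m (k : 'I_m -> option bool) : Prop :=
  exists b : 'I_m -> bool,
    (forall i, k i = Some (b i)) /\ (exists i j, b i != b j).

Definition one_real m (k : 'I_m -> option bool) : Prop :=
  exists i, forall j, (k j : bool) = (j == i).

(** The third Reidemeister move pushes the strands across one another, so that
  the triangle changes side with respect to each of them.  A bigon is layered
  iff one strand is over the other at both crossings; a triangle is layered iff
  its strands can be put at three distinct heights. *)
Inductive reidemeister (D D' : vdiagram) : Prop :=
| Renaming of renamed D D'
| Rebasing of rebased D D'
| Reidemeister1 c (k : 'I_1 -> option bool) l of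
    tangle_move (@no_crossing 1) (strand c k l) D D'
| Reidemeister2 c (k : 'I_2 -> option bool) l of
    layered k \/ k = all_virtual
    & tangle_move (@no_crossing 2) (strand c k l) D D'
| Reidemeister3 c (k : 'I_3 -> option bool) l of
    [\/ layered k, k = all_virtual | one_real k]
    & tangle_move (strand c k l) (strand c k (fun i => ~~ l i)) D D'.

Inductive xtype := vDelta_wedge | vDelta_circ | vsharp | vpass.

(** For the triangle, each strand is over at exactly one of its two crossings
  iff each strand is over the next one, or each is under the next one.  For the
  quadrilateral, the two pairs of disjoint strands are {0, 2} and {1, 3};
  opposite sides that run in opposite ways around the polygon are parallel
  strands oriented in the same direction. *)
Inductive xmove : xtype -> vdiagram -> vdiagram -> Prop :=
| XDelta_circ c (b : bool) (l : 'I_3 -> bool) D D' of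
    (forall i j, l i = l j)
    & tangle_move (strand c (fun=> Some b) l) (strand c all_virtual l) D D' :
    xmove vDelta_circ D D'
| XDelta_wedge c (b : bool) (l : 'I_3 -> bool) D D' of
    ~ (forall i j, l i = l j)
    & tangle_move (strand c (fun=> Some b) l) (strand c all_virtual l) D D' :
    xmove vDelta_wedge D D'
| XSharp c (b : bool) (l : 'I_4 -> bool) D D' of
    (forall i, l i != l (ordS (ordS i)))
    & tangle_move (strand c (fun i => Some (b (+) odd i)) l)
                  (strand c all_virtual l) D D' :
    xmove vsharp D D'
| XPass c (b : bool) (l : 'I_4 -> bool) D D' of
    (forall i, l i = l (ordS (ordS i)))
    & tangle_move (strand c (fun i => Some (b (+) odd i)) l)
                  (strand c all_virtual l) D D' :
    xmove vpass D D'.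

(** * Oriented virtual knots *)

Definition same_knot : rel vdiagram := fun D D' =>
  `[< clos_refl_sym_trans vdiagram reidemeister D D' >].

Lemma same_knot_refl : reflexive same_knot.
Proof. by move=> D; apply/asboolP; apply: rst_refl. Qed.
Lemma same_knot_sym : symmetric same_knot.
Proof.
by move=> D D'; apply/idP/idP => /asboolP h; apply/asboolP; apply: rst_sym.
Qed.
Lemma same_knot_trans : transitive same_knot.
Proof.
by move=> D2 D1 D3 /asboolP h1 /asboolP h2; apply/asboolP; apply: rst_trans h2.
Qed.

Canonical same_knot_equiv :=
  EquivRel same_knot same_knot_refl same_knot_sym same_knot_trans.

Local Open Scope quotient_scope.

Definition vknot := {eq_quot same_knot}.

Definition knot (D : vdiagram) : vknot := \pi_vknot D.

Definition trivial_knot : vknot := knot trivial_diagram.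

(** * Distances *)

(** [D] is deformed into [D'] by generalized Reidemeister moves and exactly [n]
  [X]-moves (in either direction). *)
Inductive deforms (X : xtype) : nat -> vdiagram -> vdiagram -> Prop :=
| Deforms0 D D' of same_knot D D' : deforms X 0 D D'
| DeformsS n D D1 D2 D' of
    deforms X n D D1 & xmove X D1 D2 \/ xmove X D2 D1 & same_knot D2 D' :
    deforms X n.+1 D D'.

Local Open Scope classical_set_scope.
Local Open Scope ring_scope.

(** An infimum of natural numbers in the extended reals: a minimum as soon as
  [K] and [K'] are related by [X]-moves. *)
Definition dist (R : realType) (X : xtype) (K K' : vknot) : \bar R :=
  ereal_inf [set (n%:R)%:E | n in [set n : nat |
    exists D D', [/\ knot D = K, knot D' = K' & deforms X n D D']]].

Definition unknotting (R : realType) (X : xtype) (K : vknot) : \bar R :=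
  dist R X K trivial_knot.

(** * Writhes *)

(** The Gauss diagram: the endpoints of its chords in cyclic order.  A chord is
  represented by its initial endpoint, which is its overcrossing. *)
Definition gauss (D : vdiagram) : seq passage :=
  [seq p <- word D | lev p != Virtual].

(** A crossing is positive iff (over branch, under branch) is a positively
  oriented frame. *)
Definition crossing_sign (p : passage) : int :=
  if frame p == (lev p == Over) then 1 else -1.

Definition endpoint_sign (p : passage) : int :=
  if lev p == Over then - crossing_sign p else crossing_sign p.

(** [behead] removes the initial endpoint [p] from the half-open arc. *)
Definition index_chord (D : vdiagram) (p : passage) : int :=
  \sum_(q <- behead (arc (gauss D) p (mate p))) endpoint_sign q.

Definition diagram_writhe (n : int) (D : vdiagram) : int :=
  \sum_(p <- gauss D | (lev p == Over) && (index_chord D p == n))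
     crossing_sign p.

(** For [n != 0] this does not depend on the diagram that represents [K]. *)
Definition writhe (n : int) (K : vknot) : int := diagram_writhe n (repr K).

Definition odd_writhe (K : vknot) : int :=
  \sum_(n \in [set n : int | odd `|n|%N]) writhe n K.

(* Main.v *)
(* Mark each passage of the word of a diagram with the parity of the number of
  real passages before it.  A chord has odd index iff its endpoints carry equal
  marks, so the odd writhe is the sum of the signs of these chords.  Replacing a
  tangle by another with, on each strand, the same number of real passages
  modulo 2 keeps all the marks outside the disk; so only the crossings in the
  disk matter.  In a polygon of real crossings, each side can be given a mark so
  that a crossing is odd iff the marks of its two sides differ; around the
  polygon, the number of odd crossings is even.  Hence at most two crossings of
  a triangle and at most four of a quadrilateral are odd, and for a pass-move,
  where the signs alternate around the quadrilateral, four odd crossings cancel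
  out.  The Reidemeister moves preserve the sum of the signs of the odd
  crossings in the disk for the same reasons. *)

Require Import Defs.
From mathcomp Require Import all_boot all_order all_algebra.
From mathcomp Require Import boolp classical_sets fsbigop.
From mathcomp Require Import reals constructive_ereal ereal.
From mathcomp Require Import generic_quotient.
From mathcomp Require Import zify.

Set Implicit Arguments.
Unset Strict Implicit.
Unset Printing Implicit Defensive.

Import Order.TTheory GRing.Theory Num.Theory.

Local Open Scope ring_scope.

(** * Words marked by the parity of real passages *)

Definition is_real (p : passage) : bool := lev p != Virtual.

Fixpoint mark (b : bool) (w : seq passage) : seq (passage * bool) :=
  if w is p :: w' then (p, b) :: mark (b (+) is_real p) w' else [::].

(** Each chord is counted once, at its overcrossing. The test looks for the mate with the same mark
    anywhere in [X], so the order of [X] is irrelevant and pieces of a marked word can be moved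
    freely. *)
Definition odd_sum (X : seq (passage * bool)) : int :=
  \sum_(x <- X | (lev x.1 == Over) && ((mate x.1, x.2) \in X))
     crossing_sign x.1.

Lemma mateK : involutive mate.
Proof. by move=> [[n e] []]; rewrite /mate /= negbK. Qed.

Lemma name_mate p : name (mate p) = name p.
Proof. by []. Qed.

Lemma is_real_mate p : is_real (mate p) = is_real p.
Proof. by case: p => [[n e] []]. Qed.

Lemma mate_neq p : mate p != p.
Proof. by case: p => [[n []] v]; apply/eqP => /(congr1 frame). Qed.

Lemma mark_cat b u v :
  mark b (u ++ v) = mark b u ++ mark (b (+) odd (count is_real u)) v.
Proof.
elim: u b => [|p u IH] b /=; first by rewrite addbF.
by rewrite IH oddD oddb addbA.
Qed.

Lemma map_fst_mark b w : map fst (mark b w) = w.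
Proof. by elim: w b => //= p w IH b; rewrite IH. Qed.

Lemma mark_addb a b w :
  mark (b (+) a) w = [seq (x.1, x.2 (+) a) | x <- mark b w].
Proof. by elim: w b => //= p w IH b; rewrite -IH addbAC. Qed.

Lemma filter_mark b w :
  [seq x <- mark b w | is_real x.1] = mark b [seq p <- w | is_real p].
Proof.
elim: w b => //= p w IH b.
by case: ifP => rp; rewrite IH ?rp //= ?rp // addbF.
Qed.

Lemma mem_mark w b x : uniq w -> all is_real w ->
  (x \in mark b w) = (x.1 \in w) && (x.2 == b (+) odd (index x.1 w)).
Proof.
case: x => q c /=; elim: w b => //= p w IH b /andP[pw uw] /andP[rp rw].
rewrite !inE xpair_eqE IH // rp eq_sym (eq_sym p q).
case: eqP => [->|_] /=; first by rewrite (negbTE pw) orbF addbF eq_sym.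
by rewrite addbT addNb addbN.
Qed.

Lemma perm_odd_sum X Y : perm_eq X Y -> odd_sum X = odd_sum Y.
Proof.
move=> XY; rewrite /odd_sum (perm_big _ XY) /=; apply: eq_bigl => x.
by rewrite (perm_mem XY).
Qed.

(** A mate has the same name, so the search for it cannot leave the part that contains the chord. *)
Lemma odd_sum_cat X Y :
  (forall x y, x \in X -> y \in Y -> name x.1 != name y.1) ->
  odd_sum (X ++ Y) = odd_sum X + odd_sum Y.
Proof.
move=> XY; rewrite /odd_sum big_cat /=.
congr (_ + _); rewrite big_seq_cond [RHS]big_seq_cond; apply: eq_bigl => x;
  case xX: (x \in _) => //=; rewrite mem_cat;
  case xY: ((mate x.1, x.2) \in X); case yY: ((mate x.1, x.2) \in Y) => //=.
- by have := XY _ _ xX yY; rewrite name_mate eqxx.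
- by have := XY _ _ xY xX; rewrite name_mate eqxx.
Qed.

(** Serves twice: [h] renames the crossings, or shifts all the marks by a constant. *)
Lemma odd_sum_map (h : passage * bool -> passage * bool) X :
  injective h ->
  (forall p a, h (mate p, a) = (mate (h (p, a)).1, (h (p, a)).2)) ->
  (forall x, frame (h x).1 = frame x.1) ->
  (forall x, lev (h x).1 = lev x.1) ->
  odd_sum (map h X) = odd_sum X.
Proof.
move=> hI hM hF hL; rewrite /odd_sum big_map; apply: eq_big => [x|x _].
  by rewrite hL -(mem_map hI X) hM -surjective_pairing.
by rewrite /crossing_sign hL hF.
Qed.

Lemma odd_sum_real X : odd_sum [seq x <- X | is_real x.1] = odd_sum X.
Proof.
rewrite /odd_sum big_filter_cond; apply: eq_bigl => x.
rewrite mem_filter /= is_real_mate.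
by rewrite /is_real; case: (lev _).
Qed.

(** * The odd writhe as a sum over chords with equal marks *)

(** A passage and its mate are distinct, both occur, and share a name that occurs exactly twice; so
    each occurs once. *)
Lemma well_formed_uniq w : well_formed w -> uniq w.
Proof.
move=> /allP wf; apply/count_mem_uniq => p.
case pw: (p \in w); last by apply/count_memPn; rewrite pw.
have /andP[mw /eqP c2] := wf _ pw.
apply/eqP; rewrite eqn_leq -has_count has_pred1 pw andbT.
have : (count_mem p w + count_mem (mate p) w <= 2)%N.
  rewrite -c2 -(count_predUI (pred1 p))
    (@eq_count _ (predI _ _) pred0) => [|q /=].
    rewrite count_pred0 addn0; apply: sub_count => q /= /orP[]/eqP-> //.
  by apply/negP => /andP[/eqP->]; rewrite eq_sym (negbTE (mate_neq p)).
have : (0 < count_mem (mate p) w)%N by rewrite -has_count has_pred1.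
lia.
Qed.

(** [mate] permutes the word and exchanges overcrossings with undercrossings, so the real passages
    are twice as many as the overcrossings. *)
Lemma well_formed_even w : well_formed w -> ~~ odd (count is_real w).
Proof.
move=> wf; have uw := well_formed_uniq wf.
have pm : perm_eq (map mate w) w.
  have um : uniq (map mate w) by rewrite map_inj_uniq //; apply: inv_inj mateK.
  apply: uniq_perm => // p; move/allP: wf => wf.
  apply/mapP/idP => [[q /wf/andP[mw _] ->] //|/wf/andP[mw _]].
  by exists (mate p) => //; rewrite mateK.
have := permP pm (fun p => lev p == Over); rewrite count_map /= => co.
suff -> : count is_real w = (count (fun p => lev p == Over) w
    + count (fun p => lev p == Over) w)%N by rewrite addnn odd_double.
rewrite -{2}co; elim: (w) => //= p v ->.
by rewrite /is_real; case: p => [[n e] []] /=; lia.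
Qed.

Lemma odd_size_arc (T : eqType) (s : seq T) (x y : T) :
  uniq s -> x \in s -> y \in s -> ~~ odd (size s) ->
  odd (size (arc s x y)) = odd (index x s) (+) odd (index y s).
Proof.
move=> us xs ys es; rewrite /arc.
have lx : (index x s < size s)%N by rewrite index_mem.
have ly : (index y s < size s)%N by rewrite index_mem.
rewrite size_take index_mem mem_rot ys /rot index_cat size_drop.
have E : s = take (index x s) s ++ drop (index x s) s by rewrite cat_take_drop.
(* This decides whether the arc from [x] to [y] wraps around the end of [s]; wrapping adds [size s]
   to the difference of the positions, which is even. *)
have [yd|yd] := boolP (y \in drop _ _).
  have yt : y \notin take (index x s) s.
    by move: us; rewrite {1}E cat_uniq => /and3P[_ /hasPn/(_ _ yd)].
  have : index y s = (index x s + index y (drop (index x s) s))%N.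
    by rewrite {1}E index_cat (negbTE yt) size_takel // ltnW.
  lia.
have yt : y \in take (index x s) s.
  by move: ys; rewrite {1}E mem_cat (negbTE yd) orbF.
have : index y s = index y (take (index x s) s).
  by rewrite {1}E index_cat yt.

lia.
Qed.

Lemma odd_abszD (a b : int) : odd `|(a + b)%R| = odd `|a| (+) odd `|b|.
Proof.
have oddE (c : int) : odd `|c| = ~~ (2 %| c)%Z by rewrite dvdzE dvdn2 negbK.
by rewrite !oddE; lia.
Qed.

Lemma odd_absz_sum_sign (I : Type) (r : seq I) (F : I -> int) :
  (forall i, odd `|F i|) -> odd `|(\sum_(i <- r) F i)%R| = odd (size r).
Proof.
move=> oF; elim: r => [|i r IH]; first by rewrite big_nil.
rewrite big_cons /=; by rewrite odd_abszD oF IH.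
Qed.

Definition diagram_odd_writhe (D : vdiagram) : int :=
  odd_sum (mark false (word D)).

Lemma gauss_uniq D : uniq (gauss D).
Proof.
rewrite filter_uniq // well_formed_uniq //.
by have /andP[] := code_valid D.
Qed.

Lemma mem_gauss_mate D p : p \in gauss D -> mate p \in gauss D.
Proof.
rewrite !mem_filter -!/(is_real _) is_real_mate => /andP[-> pD] /=.
by have /andP[/allP/(_ _ pD)/andP[]] := code_valid D.
Qed.

(** All endpoint signs are odd, so the parity of the index is that of the number of endpoints on the
    open arc. This number is one less than the difference of the positions of the two endpoints,
    modulo the even size of the Gauss diagram; it is odd iff the positions have the same parity. *)
Lemma odd_index_chord D p : p \in gauss D ->
  odd `|index_chord D p| =
    ((mate p, odd (index p (gauss D))) \in mark false (gauss D)).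
Proof.
move=> pG; have mG := mem_gauss_mate pG.
rewrite mem_mark ?gauss_uniq //; last by apply: filter_all.
rewrite mG /= /index_chord odd_absz_sum_sign; last first.
  by move=> q; rewrite /endpoint_sign /crossing_sign; do 2 case: ifP.
have eG : ~~ odd (size (gauss D)).
  by rewrite size_filter well_formed_even //; have /andP[] := code_valid D.
have := odd_size_arc (gauss_uniq D) pG mG eG; rewrite size_behead.
(* [size_behead] is a truncated predecessor, so the arc has to be nonempty: it starts with [p],
   which differs from its mate. *)
have : (0 < size (arc (gauss D) p (mate p)))%N.
  rewrite /arc rot_index // size_take /=; rewrite eq_sym (negbTE (mate_neq p)).
  by case: ifP.
have : odd (index p (gauss D)) \in [:: true; false] by case: (odd _).
lia.
Qed.

Lemma diagram_odd_writheE D :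
  diagram_odd_writhe D =
  \sum_(p <- gauss D | (lev p == Over) && odd `|index_chord D p|)
     crossing_sign p.
Proof.
rewrite /diagram_odd_writhe -odd_sum_real filter_mark -/(gauss D).
have eG := map_fst_mark false (gauss D).
rewrite -{2}eG big_map /odd_sum big_seq_cond [RHS]big_seq_cond.
apply: eq_bigl => -[p b] /=; case pm: ((p, b) \in _) => //=; congr (_ && _).
have pG : p \in gauss D by rewrite -eG; apply/mapP; exists (p, b).
move: pm; rewrite odd_index_chord // mem_mark ?gauss_uniq ?filter_all //=.
by case/andP=> _ /eqP ->.
Qed.

Lemma sum_writhe_odd D :
  \sum_(n \in [set n : int | odd `|n|%N]) diagram_writhe n D =
  diagram_odd_writhe D.
Proof.
pose G := gauss D.
pose s := undup [seq index_chord D p | p <- G].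
(* The sum over all odd [n] reduces to the finite list [s] of indices that occur, since any other
   [n] has no chord. Exchanging the sums then leaves, for each chord, the single term where [n] is
   its index. *)
rewrite -(@bigfs _ _ _ _ s (fun n : int => odd `|n|%N)) ?undup_uniq //;
  last first.
  move=> n _ ns; rewrite /diagram_writhe big_seq_cond big1 // => p.
  case/and3P=> pG _ /eqP En; case/negP: ns.
  by rewrite mem_undup -En map_f.
rewrite diagram_odd_writheE /diagram_writhe.
under eq_bigr do rewrite big_mkcondr.
rewrite exchange_big /= big_seq_cond [RHS]big_seq_cond [RHS]big_mkcondr /=.
rewrite big_mkcondr /=.
apply: eq_bigr => p pG; case: (lev p == Over) => //=.
rewrite big_mkcond (bigD1_seq (index_chord D p)) ?undup_uniq //=; last first.
  by rewrite mem_undup map_f.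
rewrite eqxx big1 ?addr0 // => n; rewrite eq_sym => /negbTE->.
by case: ifP.
Qed.

(** * Independence of names and base point *)

Lemma odd_writhe_renamed D D' :
  renamed D D' -> diagram_odd_writhe D' = diagram_odd_writhe D.
Proof.
case=> f [fI E]; rewrite /diagram_odd_writhe {1}/word E /=.
pose h p : passage := (f (name p), frame p, lev p).
have -> : mark false (map h (word D)) =
    [seq (h x.1, x.2) | x <- mark false (word D)].
  by elim: (word D) false => //= p w IH b; rewrite IH.
apply: odd_sum_map => //.
move=> [[[n e] v] a] [[[n' e'] v'] a'] [/fI].
by rewrite /name /frame /lev /= => -> -> -> ->.
Qed.

(** Since the real passages are even in number, the two pieces exchanged by the rotation contain the
    same number of them modulo 2. Both pieces thus have their marks shifted by the same constant
    [a], and equality of marks is unaffected. *)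
Lemma odd_writhe_rebased D D' :
  rebased D D' -> diagram_odd_writhe D' = diagram_odd_writhe D.
Proof.
case=> k [i [j [_ _ _ _ E]]]; rewrite /diagram_odd_writhe E /rot mark_cat.
have := well_formed_even (proj1 (andP (code_valid D))); rewrite -/(word D).
have := cat_take_drop k (word D); set u := take _ _; set v := drop _ _ => <-.
rewrite count_cat oddD => even_uv.
have -> : odd (count is_real v) = odd (count is_real u).
  by case: (odd _) even_uv; case: (odd _).
rewrite mark_cat !addFb; set a := odd _.
have -> : mark false v ++ mark a u =
    [seq (x.1, x.2 (+) a) | x <- mark a v ++ mark false u].
  by rewrite map_cat -!mark_addb addbb.
rewrite odd_sum_map //; last first.
  by move=> [p b] [q c] [-> /addIb ->].
by apply: perm_odd_sum; rewrite perm_catC.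
Qed.

(** * Marks inside and outside a disk *)

Definition holes m (C : seq (passage + 'I_m)) : seq 'I_m :=
  pmap (fun x => if x is inr i then Some i else None) C.

(* The marking of a filled context splits into a part [Y] outside the disk and
  the markings of the strands, whose initial marks [s] only depend on the
  parities of the numbers of real passages on the strands. *)
Lemma mark_fill m (C : seq (passage + 'I_m)) (a : 'I_m -> bool) (b : bool) :
  uniq (holes C) ->
  exists Y (s : 'I_m -> bool), forall T : 'I_m -> seq passage,
    (forall i, odd (count is_real (T i)) = a i) ->
    perm_eq (mark b (fill C T))
            (Y ++ flatten [seq mark (s i) (T i) | i <- holes C]).
Proof.
elim: C b => [|[p|i] C IH] b /=; first by exists [::], xpredT.
  move=> /(IH (b (+) is_real p))[Y [s YsE]]; exists ((p, b) :: Y), s => T Ta.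
  by rewrite /fill /= perm_cons; apply: YsE.
case/andP=> iC /(IH (b (+) a i))[Y [s YsE]].
exists Y, (fun j => if j == i then b else s j) => T Ta.
rewrite /fill /= mark_cat Ta eqxx.
rewrite perm_sym perm_catCA perm_cat2l perm_sym.
apply: perm_trans (YsE T Ta) _; rewrite perm_cat2l.
rewrite (_ : [seq _ | _ <- holes C] = [seq mark (s j) (T j) | j <- holes C]) //.
by apply/eq_in_map => j jC; case: eqP iC => // <-; rewrite jC.
Qed.

Definition marked_strands m (s : 'I_m -> bool) (T : 'I_m -> seq passage) :=
  flatten [seq mark (s i) (T i) | i <- enum 'I_m].

(** A context meeting each strand once has its holes in some order of [enum 'I_m], so the strands
    can be listed in their numerical order. *)
Lemma mark_fill_enum m (C : seq (passage + 'I_m)) (a : 'I_m -> bool) b :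
  (forall i, count_mem (inr i) C = 1%N) ->
  exists Y (s : 'I_m -> bool), forall T : 'I_m -> seq passage,
    (forall i, odd (count is_real (T i)) = a i) ->
    perm_eq (mark b (fill C T)) (Y ++ marked_strands s T).
Proof.
move=> C1.
have ch i : count_mem i (holes C) = 1%N.
  by rewrite -(C1 i) /holes; elim: (C) => //= -[p|j] C' IH //=; rewrite IH.
have uh : uniq (holes C).
  by apply/count_mem_uniq => i; rewrite -has_pred1 has_count ch.
have [Y [s YsE]] := mark_fill a b uh; exists Y, s => T /YsE{}YsE.
apply: perm_trans YsE _; rewrite perm_cat2l; apply/perm_flatten/perm_map.
apply: uniq_perm => //; first exact: enum_uniq.
by move=> i; rewrite mem_enum -has_pred1 has_count ch.
Qed.

(** * Odd crossings of a polygon *)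

Definition to_prev m (c : 'I_m -> nat) (k : 'I_m -> option bool)
    (l : 'I_m -> bool) (i : 'I_m) : passage :=
  let h := ord_pred i in (c h, l h != l i, level_decode (omap negb (k h))).

Definition to_next m (c : 'I_m -> nat) (k : 'I_m -> option bool)
    (l : 'I_m -> bool) (i : 'I_m) : passage :=
  (c i, l i == l (ordS i), level_decode (k i)).

(** [s i] is the mark with which strand [i] enters the disk. The strand meets strand [i-1] first iff
    [l i]; otherwise it has first passed crossing [i], which flips the mark if it is real.
    [next_mark] is the symmetric case. *)
Definition prev_mark m (k : 'I_m -> option bool)
    (l s : 'I_m -> bool) i : bool :=
  s i (+) (~~ l i && k i).

Definition next_mark m (k : 'I_m -> option bool)
    (l s : 'I_m -> bool) i : bool :=
  s i (+) (l i && k (ord_pred i)).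

(** The signed number of odd crossings of the polygon, expressed without the names [c]. The sign of
    crossing [i] is read from its passage on strand [i], which is over iff [b]. *)
Definition polygon_sum m (k : 'I_m -> option bool) (l s : 'I_m -> bool) : int :=
  \sum_(i < m)
    if k i is Some b then
      if next_mark k l s i == prev_mark k l s (ordS i) then
        if (l i == l (ordS i)) == b then 1 else -1
      else 0
    else 0.

Lemma is_real_decode n e o : is_real (n, e, level_decode o) = o.
Proof. by case: o => [[]|]. Qed.

Lemma is_real_prev m c k l (i : 'I_m) :
  is_real (to_prev c k l i) = k (ord_pred i).
Proof. by rewrite is_real_decode; case: (k _). Qed.

Lemma is_real_next m c k l (i : 'I_m) : is_real (to_next c k l i) = k i.
Proof. by rewrite is_real_decode. Qed.

Lemma odd_count_strand m c k l (i : 'I_m) :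
  odd (count is_real (strand c k l i)) = k (ord_pred i) (+) k i :> bool.
Proof.
rewrite /strand -/(to_prev c k l i) -/(to_next c k l i).
by case: (l i); rewrite /= is_real_prev is_real_next addn0 oddD !oddb // addbC.
Qed.

Lemma mark_strand m c k l (s : 'I_m -> bool) i :
  perm_eq (mark (s i) (strand c k l i))
    [:: (to_prev c k l i, prev_mark k l s i);
        (to_next c k l i, next_mark k l s i)].
Proof.
rewrite /strand -/(to_prev c k l i) -/(to_next c k l i).
rewrite /prev_mark /next_mark; case: (l i) => /=;
  rewrite ?is_real_prev ?is_real_next !addbF //.
by rewrite -[_ :: _ :: _]/([:: _] ++ [:: _]) perm_catC.
Qed.

Lemma mate_next m c k l (i : 'I_m) :
  mate (to_next c k l i) = to_prev c k l (ordS i).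
Proof.
rewrite /to_prev /to_next /mate /= ordSK; congr (_, _, _).
by case: (k i) => [[]|].
Qed.

Lemma mate_prev m c k l (i : 'I_m) :
  mate (to_prev c k l (ordS i)) = to_next c k l i.
Proof. by rewrite -mate_next mateK. Qed.

Lemma mem_marked_strands m c k l (s : 'I_m -> bool) x :
  x \in marked_strands s (strand c k l) ->
  exists i, x = (to_prev c k l (ordS i), prev_mark k l s (ordS i)) \/
            x = (to_next c k l i, next_mark k l s i).
Proof.
case/flattenP => X /mapP[i _ ->]; rewrite (perm_mem (mark_strand c k l s i)).
rewrite !inE => /orP[]/eqP->; last by exists i; right.
by exists (ord_pred i); left; rewrite ord_predK.
Qed.

Lemma marked_strands_mem m c k l (s : 'I_m -> bool) i :
  ((to_prev c k l i, prev_mark k l s i) \in marked_strands s (strand c k l)) &&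
  ((to_next c k l i, next_mark k l s i) \in marked_strands s (strand c k l)).
Proof.
have h x : x \in mark (s i) (strand c k l i) ->
    x \in marked_strands s (strand c k l).
  move=> xi; apply/flattenP; exists (mark (s i) (strand c k l i)) => //.
  by apply/mapP; exists i; rewrite ?mem_enum.
by rewrite !h // (perm_mem (mark_strand c k l s i)) !inE eqxx ?orbT.
Qed.

Lemma mem_marked_next m c k l (s : 'I_m -> bool) i a : injective c ->
  ((to_next c k l i, a) \in marked_strands s (strand c k l)) =
  (a == next_mark k l s i).
Proof.
move=> cI; apply/idP/eqP => [|->]; last first.
  by case/andP: (marked_strands_mem c k l s i).
case/mem_marked_strands => j [] []; rewrite /to_prev /= ?ordSK => /cI <- //.
(* The remaining case equates the two passages of one crossing, whose frames are opposite. *)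
by case: eqP.
Qed.

Lemma mem_marked_prev m c k l (s : 'I_m -> bool) i a : injective c ->
  ((to_prev c k l (ordS i), a) \in marked_strands s (strand c k l)) =
  (a == prev_mark k l s (ordS i)).
Proof.
move=> cI; apply/idP/eqP => [|->]; last first.
  by case/andP: (marked_strands_mem c k l s (ordS i)).
case/mem_marked_strands => j [] []; rewrite /to_prev /= ?ordSK => /cI <- //.
by case: eqP.
Qed.

(** Regroups by crossings a sum given by strands: shifting the index of the [to_prev] terms puts the
    two passages of each crossing in the same summand. *)
Lemma big_marked_strands m c k l (s : 'I_m -> bool)
    (F : passage * bool -> int) :
  \sum_(x <- marked_strands s (strand c k l)) F x =
  \sum_(i < m) (F (to_prev c k l (ordS i), prev_mark k l s (ordS i)) +
                F (to_next c k l i, next_mark k l s i)).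
Proof.
pose G i := F (to_prev c k l i, prev_mark k l s i).
rewrite big_split -[X in _ = X + _]/(\sum_(i < m) G (ordS i)) /=.
rewrite -(reindex (@ordS m) (P := predT)) /=; last first.
  by exists (@ord_pred m) => i _; rewrite ?ordSK ?ord_predK.
rewrite -big_split /marked_strands big_flatten big_map big_enum /=.
apply: eq_bigr => i _.
by rewrite (perm_big _ (mark_strand c k l s i)) /= !big_cons big_nil addr0.
Qed.

Lemma odd_sum_marked_strands m c k l (s : 'I_m -> bool) : injective c ->
  odd_sum (marked_strands s (strand c k l)) = polygon_sum k l s.
Proof.
move=> cI; rewrite /odd_sum big_mkcond big_marked_strands.
apply: eq_bigr => i _; rewrite mate_next mate_prev.
rewrite mem_marked_next // mem_marked_prev // /crossing_sign.
rewrite /to_prev /to_next /frame /lev /= ordSK.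
case: (k i) => [[]|] //=;
  rewrite ?add0r ?addr0 1?[prev_mark _ _ _ _ == _]eq_sym.
  by case: (_ == prev_mark _ _ _ _).
by rewrite eqb_id eqbF_neg.
Qed.

(** * Change of the odd writhe under a tangle move *)

Definition on_crossings m (c : 'I_m -> nat) (T : 'I_m -> seq passage) : Prop :=
  forall i p, p \in T i -> exists j, name p = c j.

Lemma on_crossings_strand m (c : 'I_m -> nat) k l :
  on_crossings c (strand c k l).
Proof.
move=> i p; rewrite /strand.
by case: (l i); rewrite !inE => /orP[]/eqP->; eexists.
Qed.

Lemma count_name_strands m (c : 'I_m -> nat) k l n :
  count (fun q => name q == n) (flatten [seq strand c k l i | i <- enum 'I_m]) =
  (\sum_(i < m) (c i == n)).*2.
Proof.
rewrite count_flatten -map_comp sumnE big_map big_enum /= -addnn.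
rewrite [X in (_ = X + _)%N](reindex (@ord_pred m)) /=; last first.
  by exists (@ordS m) => i _; rewrite ?ordSK ?ord_predK.
rewrite -big_split; apply: eq_bigr => i _ /=.
by rewrite /strand; case: (l i); rewrite /= /name /= addn0 // addnC.
Qed.

(* Each crossing of the polygon already occurs twice on the strands. *)
Lemma crossings_fresh m (c : 'I_m -> nat) k l w V : well_formed w ->
  perm_eq w (V ++ flatten [seq strand c k l i | i <- enum 'I_m]) ->
  injective c /\ forall p i, p \in V -> name p != c i.
Proof.
move=> /allP wf wV.
have le2 i : (count (fun q => name q == c i) V +
    (\sum_(j < m) (c j == c i)).*2 <= 2)%N.
  have : to_next c k l i \in w.
    rewrite (perm_mem wV) mem_cat; apply/orP; right; apply/flattenP.
    exists (strand c k l i); first by apply/mapP; exists i; rewrite ?mem_enum.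
    rewrite /strand -/(to_prev c k l i) -/(to_next c k l i).
    by case: (l i); rewrite !inE eqxx ?orbT.
  case/wf/andP => _; rewrite (permP wV) count_cat count_name_strands.
  by move/eqP => ->.
split=> [i j cij|p i pV].
  apply/eqP/negPn/negP => ij; have := le2 j.
  rewrite (bigD1 j) //= (bigD1 i) //= cij eqxx; lia.
apply/negP => pi; have := le2 i; rewrite (bigD1 i) //= eqxx.
suff : (0 < count (fun q => name q == c i) V)%N by lia.
by rewrite -has_count; apply/hasP; exists p.
Qed.

(** The part [Y] outside the disk is marked alike in both diagrams and shares no name with the
    strands, so its contribution cancels. Only one of the tangles is asked to be the polygon, to
    cover moves that create it; freshness of the names [c] comes from well-formedness of the diagram
    where the polygon is present. *)
Lemma tangle_move_odd_writhe m (c : 'I_m -> nat) k l T T' D D' :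
  tangle_move T T' D D' ->
  on_crossings c T -> on_crossings c T' ->
  (forall i, odd (count is_real (T i)) = odd (count is_real (T' i))) ->
  strand c k l = T \/ strand c k l = T' ->
  injective c /\ exists s : 'I_m -> bool,
    diagram_odd_writhe D - diagram_odd_writhe D' =
    odd_sum (marked_strands s T) - odd_sum (marked_strands s T').
Proof.
case=> C [C1 wD wD' _] cT cT' TT' kT.
have [Y [s YsE]] :=
  mark_fill_enum (fun i => odd (count is_real (T i))) false C1.
have wfill T0 :
    (forall i, odd (count is_real (T0 i)) = odd (count is_real (T i))) ->
    perm_eq (fill C T0) (map fst Y ++ flatten [seq T0 i | i <- enum 'I_m]).
  move=> /YsE /(perm_map fst); rewrite map_fst_mark map_cat /marked_strands.
  rewrite map_flatten -map_comp.
  rewrite [X in flatten X](eq_map (g := T0)) // => i.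
  by rewrite /= map_fst_mark.
have [cI cV] : injective c /\ forall p i, p \in map fst Y -> name p != c i.
  have [wfD wfD'] :=
    (proj1 (andP (code_valid D)), proj1 (andP (code_valid D'))).
  rewrite -!/(word _) wD wD' in wfD wfD'.
  case: kT => E.
    by apply: (@crossings_fresh m c k l _ _ wfD); rewrite E; apply: wfill.
  by apply: (@crossings_fresh m c k l _ _ wfD'); rewrite E; apply: wfill.
split=> //; exists s.
have JE T0 : on_crossings c T0 ->
    (forall i, odd (count is_real (T0 i)) = odd (count is_real (T i))) ->
    odd_sum (mark false (fill C T0)) =
    odd_sum Y + odd_sum (marked_strands s T0).
  move=> cT0 /YsE /perm_odd_sum ->; apply: odd_sum_cat => x y xY.
  case/flattenP => X /mapP[i _ ->] yi.
  have [j ->] : exists j, name y.1 = c j.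
    by apply: (cT0 i); rewrite -(map_fst_mark (s i) (T0 i)) map_f.
  by apply: cV; rewrite map_f.
rewrite /diagram_odd_writhe wD wD' !JE //; lia.
Qed.

Lemma polygon_move_odd_writhe m (c : 'I_m -> nat) k l k' l' D D' :
  tangle_move (strand c k l) (strand c k' l') D D' ->
  (forall i, k (ord_pred i) (+) k i = k' (ord_pred i) (+) k' i :> bool) ->
  exists s, diagram_odd_writhe D - diagram_odd_writhe D' =
    polygon_sum k l s - polygon_sum k' l' s.
Proof.
move=> mv kk'.
have [||||cI [s ->]] := @tangle_move_odd_writhe m c k l _ _ D D' mv.
- exact: on_crossings_strand.
- exact: on_crossings_strand.
- by move=> i; rewrite !odd_count_strand kk'.
- by left.
by exists s; rewrite !odd_sum_marked_strands.
Qed.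

Lemma polygon_birth_odd_writhe m (c : 'I_m -> nat) k l D D' :
  tangle_move (@no_crossing m) (strand c k l) D D' ->
  (forall i, k (ord_pred i) = k i :> bool) ->
  exists s, diagram_odd_writhe D' = diagram_odd_writhe D + polygon_sum k l s.
Proof.
move=> mv kk.
have [||||cI [s E]] := @tangle_move_odd_writhe m c k l _ _ D D' mv.
- by [].
- exact: on_crossings_strand.
- by move=> i; rewrite odd_count_strand kk addbb.
- by right.
exists s; move: E; rewrite odd_sum_marked_strands //.
have -> : marked_strands s (@no_crossing m) = [::].
  by rewrite /marked_strands; elim: (enum _).
by rewrite /odd_sum big_nil; lia.
Qed.

(** * Polygon sums and invariance under Reidemeister moves *)

Lemma polygon_sum_virtual m (l s : 'I_m -> bool) :
  polygon_sum all_virtual l s = 0.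
Proof. by rewrite /polygon_sum big1. Qed.

(* [s i (+) l i] is the mark of strand [i] at its crossing with strand [i+1],
  and the negation of its mark at its crossing with strand [i-1]. *)
Lemma polygon_sum_real m (k : 'I_m -> option bool) (b l s : 'I_m -> bool) :
  (forall i, k i = Some (b i)) ->
  polygon_sum k l s =
  \sum_(i < m)
    if s i (+) l i != s (ordS i) (+) l (ordS i) then
      if (l i == l (ordS i)) == b i then 1 else -1
    else 0.
Proof.
move=> kb; apply: eq_bigr => i _; rewrite /next_mark /prev_mark !kb !andbT.
by case: (s i); case: (l i); case: (s _); case: (l _).
Qed.

(** Writing the summand as a function of two adjacent strands turns small polygon sums into
    expressions in a few booleans, settled by enumeration. *)
Lemma big_ordS2 (F : 'I_2 -> 'I_2 -> int) :
  \sum_(i < 2) F i (ordS i) =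
  F (inord 0) (inord 1) + F (inord 1) (inord 0).
Proof.
rewrite !big_ord_recl big_ord0 addr0.
by congr (F _ _ + F _ _); apply: val_inj; rewrite /= ?inordK.
Qed.

Lemma big_ordS3 (F : 'I_3 -> 'I_3 -> int) :
  \sum_(i < 3) F i (ordS i) =
  F (inord 0) (inord 1) + (F (inord 1) (inord 2) + F (inord 2) (inord 0)).
Proof.
rewrite !big_ord_recl big_ord0 addr0.
by congr (F _ _ + (F _ _ + F _ _)); apply: val_inj; rewrite /= ?inordK.
Qed.

Lemma big_ordS4 (F : 'I_4 -> 'I_4 -> int) :
  \sum_(i < 4) F i (ordS i) =
  F (inord 0) (inord 1) + (F (inord 1) (inord 2) +
  (F (inord 2) (inord 3) + F (inord 3) (inord 0))).
Proof.
rewrite !big_ord_recl big_ord0 addr0.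
by congr (F _ _ + (F _ _ + (F _ _ + F _ _)));
  apply: val_inj; rewrite /= ?inordK.
Qed.

(** If the crossing of a kink is real, the mark flips between its two passages, so the crossing is
    never odd. *)
Lemma polygon_sum_monogon (k : 'I_1 -> option bool) l s : polygon_sum k l s = 0.
Proof.
rewrite /polygon_sum big_ord1 /next_mark /prev_mark.
rewrite (ord1 (ordS _)) (ord1 (ord_pred _)).
by case: (k _) => // b; case: (s _); case: (l _).
Qed.

(** Both crossings compare the same two marks, so they are odd together; being layered makes [b]
    differ at them, which gives them opposite signs. *)
Lemma polygon_sum_bigon (k : 'I_2 -> option bool) l s :
  layered k -> polygon_sum k l s = 0.
Proof.
case=> b [kb [i [j bij]]]; rewrite (polygon_sum_real _ _ kb).
rewrite (big_ordS2 (fun i j => if s i (+) l i != s j (+) l j then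
  if (l i == l j) == b i then 1 else -1 else 0)).
have b01 : b (inord 1) = ~~ b (inord 0).
  have ord2 (h : 'I_2) : h = inord 0 \/ h = inord 1.
    by case: h => [[|[|//]] hh]; [left|right];
      apply: val_inj; rewrite /= inordK.
  move: bij; case: (ord2 i) => ->; case: (ord2 j) => ->;
    by case: (b _); case: (b _).
rewrite b01; move: (s _) (s _) (l _) (l _) (b _).
by do 5 case.
Qed.

(** Reversing every [l i] with [s] fixed negates both sides of each comparison, of marks as well as
    of directions. *)
Lemma polygon_sum_negb_layered m (k : 'I_m -> option bool) l s :
  layered k -> polygon_sum k (fun i => ~~ l i) s = polygon_sum k l s.
Proof.
case=> b [kb _]; rewrite !(polygon_sum_real _ _ kb); apply: eq_bigr => i _.
by rewrite !addbN !(inj_eq negb_inj).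
Qed.

(** The other two crossings are virtual, so at the real one both strands still carry their entering
    marks [s], whatever [l] is. *)
Lemma polygon_sum_negb_one_real (k : 'I_3 -> option bool) l s :
  one_real k -> polygon_sum k (fun i => ~~ l i) s = polygon_sum k l s.
Proof.
case=> i0 ki0; apply: eq_bigr => i _.
case ki: (k i) => [b|] //; have := ki0 i; rewrite ki => /esym/eqP i_i0.
have nS : ordS i != i by case: i {ki i_i0} => [[|[|[|]]]].
have nP : ord_pred i != i by case: i {ki i_i0 nS} => [[|[|[|]]]].
by rewrite /next_mark /prev_mark !ki0 -i_i0 (negbTE nS) (negbTE nP) !andbF
  (inj_eq negb_inj).
Qed.

Lemma reidemeister_odd_writhe D D' :
  reidemeister D D' -> diagram_odd_writhe D = diagram_odd_writhe D'.
Proof.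
case=> [/odd_writhe_renamed //|/odd_writhe_rebased //|
  c k l mv|c k l hk mv|c k l hk mv].
- have [|s ->] := polygon_birth_odd_writhe mv; last first.
    by rewrite polygon_sum_monogon addr0.
  by move=> i; congr (isSome (k _)); rewrite (ord1 (ord_pred _)) (ord1 i).
- have [|s ->] := polygon_birth_odd_writhe mv.
    by case: hk => [[b [kb _]] i|-> //]; rewrite !kb.
  by case: hk => [/polygon_sum_bigon ->|->]; rewrite ?polygon_sum_virtual addr0.
- have [//|s] := polygon_move_odd_writhe mv.
  suff -> : polygon_sum k (fun i => ~~ l i) s = polygon_sum k l s.
    by rewrite subrr => /eqP; rewrite subr_eq0 => /eqP.
  case: hk => [/polygon_sum_negb_layered -> //||
    /polygon_sum_negb_one_real -> //].
  by move->; rewrite !polygon_sum_virtual.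
Qed.

Lemma same_knot_odd_writhe D D' :
  same_knot D D' -> diagram_odd_writhe D = diagram_odd_writhe D'.
Proof.
move/asboolP; elim=> // [x y /reidemeister_odd_writhe //|x y z _ -> _ ->] //.
Qed.

(** * Effect of the X-moves and bounds on distances *)

Definition xmove_bound (X : xtype) : nat := if X is vsharp then 4 else 2.

Lemma real_to_virtual_odd_writhe m (c : 'I_m -> nat) (b l : 'I_m -> bool) D D' :
  tangle_move (strand c (fun i => Some (b i)) l)
    (strand c all_virtual l) D D' ->
  exists s, diagram_odd_writhe D - diagram_odd_writhe D' =
    polygon_sum (fun i => Some (b i)) l s.
Proof.
move=> mv; have [//|s ->] := polygon_move_odd_writhe mv.
by exists s; rewrite polygon_sum_virtual subr0.
Qed.

(** Three booleans around a cycle change at zero or two adjacent pairs. This serves both kinds of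
    triangle. *)
Lemma polygon_sum_triangle (b l s : 'I_3 -> bool) :
  `|polygon_sum (fun i => Some (b i)) l s| <= 2.
Proof.
rewrite (polygon_sum_real (b := b)) //.
rewrite (big_ordS3 (fun i j => if s i (+) l i != s j (+) l j then
  if (l i == l j) == b i then 1 else -1 else 0)).
move: (s _ (+) _) (s _ (+) _) (s _ (+) _) => t0 t1 t2.
by case: t0; case: t1; case: t2 => //=; do 2 case: ifP.
Qed.

Lemma polygon_sum_square (b l s : 'I_4 -> bool) :
  `|polygon_sum (fun i => Some (b i)) l s| <= 4.
Proof.
rewrite (polygon_sum_real (b := b)) //.
apply: le_trans (ler_norm_sum _ _ _) _.
rewrite (_ : 4 = \sum_(i < 4) (1 : int)); last by rewrite sumr_const card_ord.
by apply: ler_sum => i _; case: ifP => // _; case: ifP.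
Qed.

(** As opposite sides have equal [l], the value of [l i == l (ordS i)] is the same at all four
    corners, while [b (+) odd i] alternates; hence the signs alternate. Four odd crossings then
    cancel, and otherwise at most two are odd. *)
Lemma polygon_sum_pass (b : bool) (l s : 'I_4 -> bool) :
  (forall i, l i = l (ordS (ordS i))) ->
  `|polygon_sum (fun i => Some (b (+) odd i)) l s| <= 2.
Proof.
move=> ll; rewrite (polygon_sum_real (b := fun i => b (+) odd i)) //.
rewrite (big_ordS4 (fun i j => if s i (+) l i != s j (+) l j then
  if (l i == l j) == b (+) odd i then 1 else -1 else 0)).
have -> : l (inord 2) = l (inord 0).
  by rewrite ll; congr (l _); apply: val_inj; rewrite /= !inordK.
have -> : l (inord 3) = l (inord 1).
  by rewrite ll; congr (l _); apply: val_inj; rewrite /= !inordK.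
rewrite !inordK //=.
by move: (s _) (s _) (s _) (s _) (l _) (l _) b; do 7 case.
Qed.

Lemma xmove_odd_writhe X D D' : xmove X D D' ->
  `|diagram_odd_writhe D - diagram_odd_writhe D'| <= (xmove_bound X)%:R.
Proof.
case=> c b l {}D {}D' hl mv; have [s ->] := real_to_virtual_odd_writhe mv.
- exact: polygon_sum_triangle.
- exact: polygon_sum_triangle.
- exact: polygon_sum_square.
- exact: polygon_sum_pass.
Qed.

Lemma deforms_odd_writhe X n D D' : deforms X n D D' ->
  `|diagram_odd_writhe D - diagram_odd_writhe D'| <= (n * xmove_bound X)%:R.
Proof.
elim=> [{}D {}D' /same_knot_odd_writhe ->|{}n {}D D1 D2 {}D' _ IH mv].
  by rewrite subrr normr0.
move/same_knot_odd_writhe => <-.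
have {mv} :
    `|diagram_odd_writhe D1 - diagram_odd_writhe D2| <= (xmove_bound X)%:R.
  (* The move may be applied in either direction. *)
  by case: mv => /xmove_odd_writhe //; rewrite distrC.
move=> h; rewrite mulSn natrD [leRHS]addrC.
by apply: le_trans (ler_distD (diagram_odd_writhe D1) _ _) _; rewrite lerD.
Qed.

(** [writhe] is read from the chosen representative of [K]; summed over odd [n] it gives
    [diagram_odd_writhe], whose invariance allows any other diagram of [K]. *)
Lemma odd_writheE K D : knot D = K -> odd_writhe K = diagram_odd_writhe D.
Proof.
move=> DK; rewrite /odd_writhe /writhe sum_writhe_odd.
apply: same_knot_odd_writhe.
by apply/(@eqquotP _ same_knot_equiv vknot); rewrite reprK -DK.
Qed.

Lemma odd_writhe_trivial : odd_writhe trivial_knot = 0.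
Proof.
by rewrite (odd_writheE (erefl : knot trivial_diagram = _)) /diagram_odd_writhe
  /odd_sum big_nil.
Qed.

Lemma dist_odd_writhe (R : realType) X K K' :
  ((`|odd_writhe K - odd_writhe K'|%:~R / (xmove_bound X)%:R : R)%:E
     <= dist R X K K')%E.
Proof.
apply: le_ereal_inf_tmp => _ [n [D [D' [DK DK' /deforms_odd_writhe h]]] <-].
rewrite lee_fin (odd_writheE DK) (odd_writheE DK').
rewrite ler_pdivrMr; last by case: X {h}; rewrite ltr0n.
by rewrite -natrM -[X in _ <= X]mulrz_nat ler_int.
Qed.

Theorem proposition5p2 (R : realType) :
  (forall K K' : vknot,
     (forall X : xtype, X = vDelta_wedge \/ X = vDelta_circ \/ X = vpass ->
        (((1 / 2) * `|odd_writhe K - odd_writhe K'|%:~R : R)%:E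
           <= dist R X K K')%E) /\
     (((1 / 4) * `|odd_writhe K - odd_writhe K'|%:~R : R)%:E
        <= dist R vsharp K K')%E) /\
  (forall K : vknot,
     (forall X : xtype, X = vDelta_wedge \/ X = vDelta_circ \/ X = vpass ->
        (((1 / 2) * `|odd_writhe K|%:~R : R)%:E <= unknotting R X K)%E) /\
     (((1 / 4) * `|odd_writhe K|%:~R : R)%:E <= unknotting R vsharp K)%E).
Proof.
have bound (a : R) n : 1 / n%:R * a = a / n%:R by rewrite div1r mulrC.
have dist2 K K' X : X = vDelta_wedge \/ X = vDelta_circ \/ X = vpass ->
    (((1 / 2) * `|odd_writhe K - odd_writhe K'|%:~R : R)%:E <= dist R X K K')%E.
  by move=> hX; rewrite bound; have := dist_odd_writhe R X K K';
     case: hX => [|[]] ->.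
have dist4 K K' :
    (((1 / 4) * `|odd_writhe K - odd_writhe K'|%:~R : R)%:E
       <= dist R vsharp K K')%E.
  by rewrite bound; apply: (dist_odd_writhe R vsharp).
split=> [K K'|K]; first by split=> [X|]; [apply: dist2|apply: dist4].
split=> [X hX|].
  by have := dist2 K trivial_knot X hX; rewrite odd_writhe_trivial subr0.
by have := dist4 K trivial_knot; rewrite odd_writhe_trivial subr0.
Qed.
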